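(* Let $N,M\ge 1$ be integers, let $\bm{A}_{\mathrm{intra}}\in\mathbb{R}^{N\times N}$ and $\bm{A}_{\mathrm{inter}}\in\mathbb{R}^{M\times M}$ be matrices with zero diagonal, and let $\omega_{\mathrm{intra}},\omega_{\mathrm{inter}}\in\mathbb{R}$. Let $\bm{\psi}^*=(\psi_1^*,\dots,\psi_N^* )$ be a solution of the intra-layer system $$\frac{d\psi_i}{dt}=\omega_{\mathrm{intra}}+\sum_{j=1}^{N}(\bm{A}_{\mathrm{intra}})_{ij}\sin(\psi_j-\psi_i),\qquad 1\le i\le N,$$ and let $\bm{\phi}^*=(\phi_1^*,\dots,\phi_M^* )$ be a solution of the inter-layer system $$\frac{d\phi_l}{dt}=\omega_{\mathrm{inter}}+\sum_{k=1}^{M}(\bm{A}_{\mathrm{inter}})_{lk}\sin(\phi_k-\phi_l),\qquad 1\le l\le M.$$ Then the functions $(\bm{\theta}_l^* )_i=\psi_i^*+\phi_l^*$ ($1\le l\le M$, $1\le i\le N$) form a solution of the multiplex system $$\frac{d(\bm{\theta}_l)_i}{dt}=(\omega_{\mathrm{inter}}+\omega_{\mathrm{intra}})+\sum_{j=1}^{N}(\bm{A}_{\mathrm{intra}})_{ij}\sin\big((\bm{\theta}_l)_j-(\bm{\theta}_l)_i\big)+\sum_{\substack{k=1\\ k\ne l}}^{M}\sum_{j=1}^{N}\big((\bm{A}_{\mathrm{inter}})_{lk}\bm{I}_N\big)_{ij}\sin\big((\bm{\theta}_k)_j-(\bm{\theta}_l)_i\big).$$ Equivalently, writing $\theta^*_{N(l-1)+i}=\psi_i^*+\phi_l^*$,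 that is, $$\bm{\theta}^*=(\psi_1^*+\phi_1^*,\dots,\psi_N^*+\phi_1^*,\ \psi_1^*+\phi_2^*,\dots,\psi_N^*+\phi_2^*,\ \dots,\ \psi_1^*+\phi_M^*,\dots,\psi_N^*+\phi_M^* ),$$ the vector $\bm{\theta}^*$ is a solution of $$\frac{d\theta_i}{dt}=(\omega_{\mathrm{inter}}+\omega_{\mathrm{intra}})+\sum_{j=1}^{NM}\bm{K}_{ij}\sin(\theta_j-\theta_i),\qquad 1\le i\le NM,$$ where $\bm{K}=\bm{A}_{\mathrm{intra}}\bigoplus\bm{A}_{\mathrm{inter}}$.
   Context: $\bm{I}_N$ is the $N\times N$ identity matrix. Solutions are differentiable functions of time $t$ on a common time interval; phases are regarded as real numbers (modulo $2\pi$). Kronecker product convention: for $\bm{A}\in\mathbb{R}^{p\times q}$ and $\bm{B}=[b_{ij}]\in\mathbb{R}^{r\times s}$, $\bm{A}\otimes\bm{B}\in\mathbb{R}^{pr\times qs}$ is the block matrix whose $(i,j)$ block is $\bm{A}b_{ij}$. For $\bm{A}\in\mathbb{R}^{r\times r}$, $\bm{B}\in\mathbb{R}^{s\times s}$, the Kronecker sum is $\bm{A}\bigoplus\bm{B}=\bm{A}\otimes\bm{I}_s+\bm{I}_r\otimes\bm{B}$. Hence $\bm{K}=\bm{A}_{\mathrm{intra}}\bigoplus\bm{A}_{\mathrm{inter}}$ is the $NM\times NM$ matrix made of $M\times M$ blocks of size $N\times N$, with every diagonal block equal to $\bm{A}_{\mathrm{intra}}$ and with $(l,k)$ block $(\bm{A}_{\mathrm{inter}})_{lk}\bm{I}_N$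 for $l\neq k$. *)

(* Defs.v *)
From HB Require Import structures.
From mathcomp Require Import all_boot all_order all_algebra.
From mathcomp Require Import all_classical all_reals all_analysis.
From mathcomp Require Import mxtens.

Set Implicit Arguments.
Unset Strict Implicit.
Unset Printing Implicit Defensive.

Import Order.TTheory GRing.Theory Num.Theory.
Import numFieldNormedType.Exports.

Local Open Scope classical_set_scope.
Local Open Scope ring_scope.

(* Derivative relative to a time interval J, so that J may be open, closed or
   half-open: one-sided at an endpoint belonging to J, and the usual derivative
   at an interior point (has_derivative_in_interior below). *)
Definition has_derivative_in (R : realType) (J : interval R) (f : R -> R)
    (t l : R) : Prop :=
  (fun s => (f s - f t) / (s - t)) @ within [set` J] t^' --> l.

Lemma has_derivative_in_interior (R : realType) (J : interval R) (f : R -> R)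
    (t l : R) :
  [set` J]° t -> has_derivative_in J f t l <-> is_derive t 1 f l.
Proof.
move=> Jt; set q := fun s => (f s - f t) / (s - t).
have wE : within [set` J] t^' = t^'.
  apply/seteqP; split => A /=; rewrite /within /= => tA.
  - have tJ : \forall s \near t^', [set` J] s by exact: nbhs_dnbhs.
    by near=> s; apply: (near tA s) => //; near: s.
  - by near=> s => _; near: s.
have shE (A : set R) : t^' A <-> 0^' (fun h => A (h + t)).
  split => /nbhs_ballP[e /= e0 eA]; apply/nbhs_ballP; exists e => // s /= ts s0.
  - apply: eA => /=.
      by move: ts; rewrite /ball /= sub0r normrN opprD addrCA subrr addr0 normrN.
    by rewrite -subr_eq0 addrK.
  - rewrite -(subrK t s); apply: eA => /=; last by rewrite subr_eq0.
    by move: ts; rewrite /ball /= sub0r normrN distrC.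
have qE : q @ t^' = (fun h => h^-1 *: ((f \o shift t) (h *: 1) - f t)) @ 0^'.
  apply/funext => A; apply/propext; rewrite /fmap /= /nbhs /=.
  rewrite [X in X <-> _]shE.
  suff -> : (fun h => (q @^-1` A) (h + t)) =
    ((fun h => h^-1 *: ((f \o shift t) (h *: 1) - f t)) @^-1` A) by [].
  apply/funext => h; rewrite /preimage /q /= addrK /shift /=.
  by rewrite /GRing.scale /= mulr1 mulrC.
rewrite /has_derivative_in wE -/q qE; split=> [ql|[dq <-]].
- by apply: DeriveDef; [apply/cvg_ex; exists l|apply/cvg_lim].
- exact: dq.
Unshelve. all: by end_near.
Qed.

(* Phases are not reduced modulo 2 pi. *)
Definition is_kuramoto_solution (R : realType) (J : interval R) (n : nat)
    (omega : R) (A : 'M[R]_n) (theta : 'I_n -> R -> R) : Prop :=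
  forall (i : 'I_n) (t : R), t \in J ->
    has_derivative_in J (theta i) t
      (omega + \sum_(j < n) A i j * sin (theta j t - theta i t)).

(* theta l i is the phase of node i in layer l *)
Definition is_multiplex_solution (R : realType) (J : interval R) (N M : nat)
    (omega_intra omega_inter : R) (A_intra : 'M[R]_N) (A_inter : 'M[R]_M)
    (theta : 'I_M -> 'I_N -> R -> R) : Prop :=
  forall (l : 'I_M) (i : 'I_N) (t : R), t \in J ->
    has_derivative_in J (theta l i) t
      ((omega_inter + omega_intra)
       + \sum_(j < N) A_intra i j * sin (theta l j t - theta l i t)
       + \sum_(k < M | k != l) \sum_(j < N)
           (A_inter l k *: (1%:M : 'M[R]_N)) i j
             * sin (theta k j t - theta l i t)).

(* In the convention used here the (i, j) block of A (x) B is A b_ij, whereas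
   the (i, j) block of the library's A *t B is a_ij B: the factors are swapped,
   and so are the factors of the dimensions. *)
Definition kron (R : realType) (p q r s : nat) (A : 'M[R]_(p, q))
    (B : 'M[R]_(r, s)) : 'M[R]_(r * p, s * q) := tensmx B A.

Definition kron_sum (R : realType) (r s : nat) (A : 'M[R]_r) (B : 'M[R]_s) :
  'M[R]_(s * r) := kron A (1%:M : 'M[R]_s) + kron (1%:M : 'M[R]_r) B.

(* mxtens_index (l, i) is the position l * N + i, counted from 0. *)
Lemma kron_sumE (R : realType) (N M : nat) (A : 'M[R]_N) (B : 'M[R]_M)
    (l k : 'I_M) (i j : 'I_N) :
  kron_sum A B (mxtens_index (l, i)) (mxtens_index (k, j)) =
  A i j * (l == k)%:R + (i == j)%:R * B l k.
Proof.
by rewrite /kron_sum /kron mxE !tensmxE !mxE; congr (_ + _); rewrite mulrC.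
Qed.

(* (psi_1 + phi_1, ..., psi_N + phi_1, ..., psi_1 + phi_M, ..., psi_N + phi_M):
   position p carries psi_(p mod N) + phi_(p div N), counting from 0. *)
Definition stacked_sum (R : realType) (N M : nat) (psi : 'I_N -> R -> R)
    (phi : 'I_M -> R -> R) : 'I_(M * N) -> R -> R :=
  fun p t => psi (mxtens_unindex p).2 t + phi (mxtens_unindex p).1 t.

(* Main.v *)
Require Import Defs.
From mathcomp Require Import all_boot all_order all_algebra.
From mathcomp Require Import all_classical all_reals all_analysis.
From mathcomp Require Import mxtens.
Import Order.TTheory GRing.Theory Num.Theory.
Local Open Scope ring_scope.

(** Both coupling sums only involve differences of phases.  For the phases
    psi_i + phi_l, two nodes of the same layer differ by psi_j - psi_i, because
    phi_l cancels, and the copies of a node in two layers differ by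
    phi_k - phi_l, because psi_i cancels.  Inter-layer links join only copies
    of the same node, so no other difference occurs: the multiplex vector field
    splits into the intra-layer field at psi plus the inter-layer field at phi,
    which is the derivative of psi_i + phi_l by [has_derivative_inD].

    The flattened form is the same system: in the row of the Kronecker sum
    indexed by (l, i), the only entries that survive are those of the layer l
    and those of the copies of i ([sum_kron_sum]).  This holds for an arbitrary
    family of phases ([multiplex_solutionE]), so the sum ansatz needs to be
    checked in one form only. *)

Lemma has_derivative_inD {R : realType} {J : interval R} {f g : R -> R}
    {t a b : R} :
  has_derivative_in J f t a -> has_derivative_in J g t b ->
  has_derivative_in J (fun s => f s + g s) t (a + b).
Proof.
rewrite /has_derivative_in => fa gb.
under eq_fun do rewrite opprD addrACA mulrDl.
exact: cvgD fa gb.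
Qed.

Lemma sum_mxtens_index {R : nmodType} (M N : nat) (F : 'I_(M * N) -> R) :
  \sum_p F p = \sum_(l < M) \sum_(i < N) F (mxtens_index (l, i)).
Proof.
rewrite pair_big (reindex (@mxtens_index M N)) /=.
  by apply: eq_bigr => -[l i].
by exists (@mxtens_unindex M N) => p _;
  [exact: mxtens_indexK | exact: mxtens_unindexK].
Qed.

Lemma sum_scalar_row {R : realType} (N : nat) (b : R) (i : 'I_N)
    (x : 'I_N -> R) :
  \sum_(j < N) (b *: (1%:M : 'M[R]_N)) i j * x j = b * x i.
Proof.
rewrite (bigD1 i) //= big1 ?addr0 => [|j /negPf ji].
  by rewrite !mxE eqxx mulr1.
by rewrite !mxE eq_sym ji mulr0 mul0r.
Qed.

(** A zero diagonal entry makes the restriction k != l immaterial, so that the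
    inter-layer coupling of a node is a full sum over the layers. *)
Lemma sum_inter_coupling {R : realType} (N M : nat) (B : 'M[R]_M) (l : 'I_M)
    (i : 'I_N) (x : 'I_M -> 'I_N -> R) :
  B l l = 0 ->
  \sum_(k < M | k != l) \sum_(j < N) (B l k *: (1%:M : 'M[R]_N)) i j * x k j
  = \sum_(k < M) B l k * x k i.
Proof.
move=> Bll; rewrite [RHS](bigD1 l) //= Bll mul0r add0r.
by apply: eq_bigr => k _; exact: sum_scalar_row.
Qed.

(** By [kron_sumE], the term of A is supported on the layer k = l and the term
    of B on the copies j = i of the node i. *)
Lemma sum_kron_sum {R : realType} (N M : nat) (A : 'M[R]_N) (B : 'M[R]_M)
    (l : 'I_M) (i : 'I_N) (x : 'I_(M * N) -> R) :
  \sum_p kron_sum A B (mxtens_index (l, i)) p * x p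
  = \sum_(j < N) A i j * x (mxtens_index (l, j))
    + \sum_(k < M) B l k * x (mxtens_index (k, i)).
Proof.
rewrite sum_mxtens_index.
under eq_bigr do under eq_bigr do rewrite kron_sumE mulrDl.
under eq_bigr do rewrite big_split.
rewrite big_split /=; congr (_ + _).
  rewrite (bigD1 l) //= [X in _ + X]big1 ?addr0 => [|k /negPf kl].
    by apply: eq_bigr => j _; rewrite eqxx mulr1.
  by apply: big1 => j _; rewrite eq_sym kl mulr0 mul0r.
apply: eq_bigr => k _.
rewrite (bigD1 i) //= big1 ?addr0 => [|j /negPf ji].
  by rewrite eqxx mul1r.
by rewrite eq_sym ji !mul0r.
Qed.

(** The two systems have the same vector field, component by component, once
    both inter-layer couplings are written as a sum over all layers. *)
Lemma multiplex_solutionE {R : realType} (J : interval R) (N M : nat)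
    (omega_intra omega_inter : R) (A : 'M[R]_N) (B : 'M[R]_M)
    (theta : 'I_M -> 'I_N -> R -> R) :
  (forall l, B l l = 0) ->
  is_multiplex_solution J omega_intra omega_inter A B theta <->
  is_kuramoto_solution J (omega_inter + omega_intra) (kron_sum A B)
    (fun p => theta (mxtens_unindex p).1 (mxtens_unindex p).2).
Proof.
move=> B0.
have fieldE l i t :
    omega_inter + omega_intra
    + \sum_(j < N) A i j * sin (theta l j t - theta l i t)
    + \sum_(k < M | k != l) \sum_(j < N) (B l k *: (1%:M : 'M[R]_N)) i j
        * sin (theta k j t - theta l i t)
  = omega_inter + omega_intra
    + \sum_p kron_sum A B (mxtens_index (l, i)) p
        * sin (theta (mxtens_unindex p).1 (mxtens_unindex p).2 t
               - theta l i t).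
  rewrite sum_kron_sum (sum_inter_coupling _ _ _ _ _
    (fun k j => sin (theta k j t - theta l i t)) (B0 l)) -addrA.
  by congr (_ + (_ + _)); apply: eq_bigr => ? _; rewrite mxtens_indexK.
split=> [sol p t tJ | sol l i t tJ].
  rewrite -(mxtens_unindexK p); case: (mxtens_unindex p) => l i.
  by rewrite mxtens_indexK /= -fieldE; exact: sol.
by rewrite fieldE; have := sol (mxtens_index (l, i)) t tJ; rewrite mxtens_indexK.
Qed.

Theorem mainTheorem1 (R : realType) (N M : nat)
    (N_ge1 : (1 <= N)%N) (M_ge1 : (1 <= M)%N)
    (A_intra : 'M[R]_N) (A_inter : 'M[R]_M)
    (A_intra_diag : forall i : 'I_N, A_intra i i = 0)
    (A_inter_diag : forall l : 'I_M, A_inter l l = 0)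
    (omega_intra omega_inter : R) (J : interval R)
    (psi : 'I_N -> R -> R) (phi : 'I_M -> R -> R)
    (psi_sol : is_kuramoto_solution J omega_intra A_intra psi)
    (phi_sol : is_kuramoto_solution J omega_inter A_inter phi) :
  is_multiplex_solution J omega_intra omega_inter A_intra A_inter
    (fun (l : 'I_M) (i : 'I_N) (t : R) => psi i t + phi l t)
  /\
  is_kuramoto_solution J (omega_inter + omega_intra)
    (kron_sum A_intra A_inter) (stacked_sum psi phi).
Proof.
suff sol : is_multiplex_solution J omega_intra omega_inter A_intra A_inter
    (fun l i t => psi i t + phi l t).
  split=> //.
  by apply/(multiplex_solutionE _ _ _ _ _ _ _ (fun l i t => psi i t + phi l t)
    A_inter_diag).
move=> l i t tJ.
rewrite (sum_inter_coupling _ _ _ _ _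
  (fun k j => sin (psi j t + phi k t - (psi i t + phi l t))) (A_inter_diag l)).
(* phi l t cancels inside the layer l, and psi i t between copies of node i *)
under eq_bigr do rewrite [psi i t + _]addrC addrKA.
under [X in _ + _ + X]eq_bigr => k _ do rewrite [psi i t + phi k t]addrC addrKA.
rewrite (addrC omega_inter) -addrA addrACA.
exact: has_derivative_inD (psi_sol i t tJ) (phi_sol l t tJ).
Qed.
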